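(* Let $S\subseteq(A\times B)\times O$ and $T\subseteq(P\times Q)\times Z$ be communication problems, and let $\Lambda$ be a $\delta$-fooling set of $T$. Then $\mathsf{L}(S\times T)\geq\mathsf{L}(S)/\delta$. In particular, $$\log\mathsf{L}(S\times T)\geq\log\mathsf{L}(S)+\log\mathsf{Cov}(T)-\log\log|P||Q|-4.$$
   Context: A communication problem is a relation $S\subseteq (X\times Y)\times Z$ with $X,Y,Z$ finite (Alice gets $x$, Bob gets $y$, they must output $z$ with $(x,y,z)\in S$); every $(x,y)$ has at least one valid $z$. A rectangle is $X'\times Y'$ with $X'\subseteq X,Y'\subseteq Y$; it is monochromatic with color $z$ if $(x,y,z)\in S$ for all its elements. $\mathsf{Cov}(S)$ is the minimum number of monochromatic rectangles whose union is $X\times Y$. A deterministic protocol is a rooted binary tree where each node $v$ is owned by Alice or Bob and carries a rectangle $R_v=X_v\times Y_v$, the root carries $X\times Y$, the children of an Alice node partition $X_v$ (keeping $Y_v$), the children of a Bob node partition $Y_v$ (keeping $X_v$), and each leaf carries a monochromatic rectangle whose color is the output. $\mathsf{L}(S)$ is the minimum number of leaves of a protocol for $S$. The direct sum $S\times T$ is the problem where Alice gets $(a,p)\in A\times P$, Bob gets $(b,q)\in B\times Q$, and a valid output is $(o,z)$ with $(a,b,o)\in S$ and $(p,q,z)\in T$. A set $\Lambda\subseteq P\times Q$ is a $\delta$-fooling set of $T$ if for every $\tilde\Lambda\subseteq\Lambda$ with $|\tilde\Lambda|/|\Lambda|>\delta$ no monochromatic rectangle of $T$ contains all of $\tilde\Lambda$.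 Logarithms are base 2. *)

(* Defs.v *)
From HB Require Import structures.
From mathcomp Require Import all_boot all_order all_algebra.
From mathcomp Require Import boolp reals exp.

Set Implicit Arguments.
Unset Strict Implicit.
Unset Printing Implicit Defensive.

Import Order.TTheory GRing.Theory Num.Theory.

(* The input sets are required to be nonempty: if X * Y is empty then one leaf
   suffices, also for any direct sum with S, whatever the other summand, and if
   Z is empty too there is no protocol at all. *)
Record comm_problem (X Y Z : finType) := CommProblem {
  valid :> {set (X * Y) * Z};
  inputX_gt0 : 0 < #|X|;
  inputY_gt0 : 0 < #|Y|;
  valid_total : forall x y, exists z, (x, y, z) \in valid }.

Section Problem.
Variables (X Y Z : finType) (S : comm_problem X Y Z).

Definition is_rectangle (R : {set X * Y}) : bool :=
  [exists X' : {set X}, exists Y' : {set Y}, R == setX X' Y'].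

Definition mono_with (R : {set X * Y}) (z : Z) : bool :=
  [forall w in R, (w, z) \in valid S].

Definition mono_rectangle (R : {set X * Y}) : bool :=
  is_rectangle R && [exists z, mono_with R z].

Definition mono_cover (C : {set {set X * Y}}) : bool :=
  [forall R in C, mono_rectangle R] && (cover C == [set: X * Y]).

Lemma mono_cover_exists :
  exists n, [exists C : {set {set X * Y}}, mono_cover C && (#|C| == n)].
Proof.
exists #|[set [set w] | w : X * Y]|; apply/existsP.
exists [set [set w] | w : X * Y]; rewrite eqxx andbT; apply/andP; split.
  apply/forall_inP => _ /imsetP[[x y] _ ->]; apply/andP; split.
    apply/existsP; exists [set x]; apply/existsP; exists [set y].
    by apply/eqP/setP => -[a b]; rewrite !inE /= xpair_eqE.
  have [z Sz] := valid_total S x y; apply/existsP; exists z.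
  by apply/forall_inP => w /set1P ->.
apply/eqP/setP => w; rewrite inE; apply/bigcupP; exists [set w].
  exact: imset_f.
by rewrite inE.
Qed.

Definition Cov : nat := ex_minn mono_cover_exists.

(* protocol X' Y' is the type of protocol trees whose root carries the
   rectangle X' * Y'.  Empty parts are allowed in the partitions. *)
Inductive protocol : {set X} -> {set Y} -> Type :=
| Leaf X' Y' z : mono_with (setX X' Y') z -> protocol X' Y'
| Alice X' Y' X1 X2 : X1 :|: X2 = X' -> [disjoint X1 & X2] ->
    protocol X1 Y' -> protocol X2 Y' -> protocol X' Y'
| Bob X' Y' Y1 Y2 : Y1 :|: Y2 = Y' -> [disjoint Y1 & Y2] ->
    protocol X' Y1 -> protocol X' Y2 -> protocol X' Y'.

Fixpoint leaves X' Y' (p : protocol X' Y') : nat :=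
  match p with
  | Leaf _ _ _ _ => 1
  | Alice _ _ _ _ _ _ p1 p2 => leaves p1 + leaves p2
  | Bob _ _ _ _ _ _ p1 p2 => leaves p1 + leaves p2
  end.

Lemma protocol_inhabited X' Y' : inhabited (protocol X' Y').
Proof.
have [x0 _] := card_gt0P (inputX_gt0 S); have [y0 _] := card_gt0P (inputY_gt0 S).
have [z0 _] := valid_total S x0 y0.
have split1 (U : finType) (V : {set U}) u : u \in V ->
    ([set u] :|: V :\ u = V) * [disjoint [set u] & V :\ u].
  by move=> uV; rewrite setD1K // disjoints1 !inE eqxx.
have row x V : inhabited (protocol [set x] V).
  have [n] := ubnP #|V|; elim: n V => // n IHn V leVn.
  have [->|[y yV]] := set_0Vmem V.
    by constructor; apply: (@Leaf _ _ z0); apply/forall_inP => -[a b]; rewrite !inE andbF.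
  have [|p] := IHn (V :\ y); first by rewrite (cardsD1 y V) yV in leVn.
  have [eV dV] := split1 _ _ _ yV; have [z Sz] := valid_total S x y.
  constructor; apply: (Bob eV dV) p; apply: (@Leaf _ _ z).
  by apply/forall_inP => -[a b]; rewrite !inE => /andP[/eqP/= -> /eqP/= ->].
have [n] := ubnP #|X'|; elim: n X' => // n IHn V leVn.
have [->|[x xV]] := set_0Vmem V.
  by constructor; apply: (@Leaf _ _ z0); apply/forall_inP => -[a b]; rewrite !inE.
have [|p] := IHn (V :\ x); first by rewrite (cardsD1 x V) xV in leVn.
have [eV dV] := split1 _ _ _ xV; have [p1] := row x Y'.
by constructor; apply: (Alice eV dV).
Qed.

Lemma leaves_exists :
  exists n, `[< exists p : protocol [set: X] [set: Y], leaves p = n >].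
Proof.
have [p] := protocol_inhabited [set: X] [set: Y].
by exists (leaves p); apply/asboolP; exists p.
Qed.

Definition L : nat := ex_minn leaves_exists.

Definition fooling_set (R : realType) (delta : R) (Lam : {set X * Y}) : Prop :=
  forall Lam' : {set X * Y}, Lam' \subset Lam ->
    (delta < #|Lam'|%:R / #|Lam|%:R)%R ->
    ~ exists2 W : {set X * Y}, mono_rectangle W & Lam' \subset W.

End Problem.

Section DirectSum.
Variables (A B O P Q Z : finType).
Variables (S : comm_problem A B O) (T : comm_problem P Q Z).

Definition dsum_valid : {set ((A * P) * (B * Q)) * (O * Z)} :=
  [set w | let: (((a, p), (b, q)), (o, z)) := w in
           ((a, b, o) \in valid S) && ((p, q, z) \in valid T)].

Lemma dsum_inputX_gt0 : 0 < #|{: A * P}|.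
Proof. by rewrite card_prod muln_gt0 (inputX_gt0 S) (inputX_gt0 T). Qed.

Lemma dsum_inputY_gt0 : 0 < #|{: B * Q}|.
Proof. by rewrite card_prod muln_gt0 (inputY_gt0 S) (inputY_gt0 T). Qed.

Lemma dsum_total x y : exists z, (x, y, z) \in dsum_valid.
Proof.
case: x y => [a p] [b q].
have [o So] := valid_total S a b; have [z Tz] := valid_total T p q.
by exists (o, z); rewrite inE So.
Qed.

Definition dsum : comm_problem (A * P)%type (B * Q)%type (O * Z)%type :=
  CommProblem dsum_inputX_gt0 dsum_inputY_gt0 dsum_total.

End DirectSum.

Definition log2 (R : realType) (x : R) : R := (ln x / ln 2)%R.

(* Main.v *)
Require Import Defs.
From HB Require Import structures.
From mathcomp Require Import all_boot all_order all_algebra.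
From mathcomp Require Import boolp reals sequences exp.
From mathcomp Require Import lra zify.
Import Order.TTheory GRing.Theory Num.Theory.
Local Open Scope ring_scope.

(** Project each leaf rectangle [X' * Y'] of an optimal protocol for [S * T] to
    the set of [(p, q)] that it meets: this is a monochromatic rectangle of [T].
    Fixing the [T]-input to [(p, q)] and pruning the leaves that become empty
    gives a protocol for [S], so every [(p, q)] lies in at least [L S] of the
    [L (S * T)] projections.  Double counting incidences with a fooling set
    gives the first bound.  For the second one, the projections form a
    fractional cover of weight [L (S * T) / L S], which the greedy algorithm
    turns into a genuine cover at the cost of a logarithmic factor. *)

Set Implicit Arguments.
Unset Strict Implicit.

(** * Families covering each point at least [k] times, and the greedy algorithm *)

Section Multicover.
Variables (U : finType) (s : seq {set U}) (k : nat).
Local Open Scope nat_scope.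
Hypothesis covers_k : forall x, k <= count (fun W : {set U} => x \in W) s.

Lemma multicover_card (V : {set U}) :
  k * #|V| <= \sum_(W <- s) #|V :&: W|.
Proof.
have -> : \sum_(W <- s) #|V :&: W| =
    \sum_(x in V) count (fun W : {set U} => x \in W) s.
  under eq_bigr => W _ do rewrite -sum1_card.
  under [RHS]eq_bigr => x _ do rewrite -sum1_count big_mkcond.
  rewrite [RHS]exchange_big; apply: eq_bigr => W _ /=.
  by rewrite -big_mkcondr; apply: eq_bigl => x; rewrite !inE.
by rewrite mulnC -sum_nat_const; apply: leq_sum.
Qed.

(** Averaging: some member covers at least a [k / size s] fraction of [V]. Otherwise summing the
    strict inequalities contradicts [multicover_card]. *)
Lemma multicover_pick (V : {set U}) : 0 < size s ->
  exists2 W, W \in s & k * #|V| <= size s * #|V :&: W|.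
Proof.
move=> s_gt0; apply/hasP; apply: contraT => /hasPn noW.
have : \sum_(W <- s) (size s * #|V :&: W|).+1 <= \sum_(W <- s) k * #|V|.
  rewrite big_seq [X in _ <= X]big_seq; apply: leq_sum => W /noW.
  by rewrite -ltnNge.
under eq_bigr do rewrite -addn1.
rewrite big_split /= -big_distrr /= !big_const_seq !count_predT !iter_addn_0.
rewrite mul1n.
have := leq_mul (leqnn (size s)) (multicover_card V); lia.
Qed.

(** Each greedy choice shrinks the uncovered set by a factor [1 - k / size s]; denominators are
    cleared to stay in [nat]. *)
Lemma greedy_cover t : 0 < size s -> k <= size s ->
  exists c : seq {set U}, [/\ {subset c <= s}, size c = t &
    #|~: \bigcup_(W <- c) W| * size s ^ t <= #|U| * (size s - k) ^ t].
Proof.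
move=> s_gt0 le_ks; elim: t => [|t [c [sub_c sz_c le_c]]].
  by exists [::]; rewrite big_nil setC0 cardsT.
have [W sW leW] := multicover_pick (~: \bigcup_(W <- c) W) s_gt0.
exists (W :: c); split; last 1 first.
- rewrite big_cons setCU setIC -setDE !expnS.
  have := cardsID W (~: \bigcup_(W <- c) W).
  set u := #|~: _| in le_c leW *; set i := #|_ :&: W| in leW *.
  set d := #|_ :\: W| => uE.
  (* Here [u = i + d], and the choice of [W] gives [k * u <= size s * i]. *)
  have le_d : size s * d <= (size s - k) * u by nia.
  rewrite mulnCA mulnA (mulnCA #|U|).
  apply: leq_trans (leq_mul le_d (leqnn (size s ^ t))) _.
  by rewrite -mulnA leq_mul2l le_c orbT.
- by move=> V; rewrite inE => /predU1P[-> | /sub_c].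
- by rewrite /= sz_c.
Qed.

End Multicover.

(** * From a protocol for the direct sum to a multicover by projected leaves *)

Section Slices.
Variables (A B O P Q Z : finType).
Variables (S : comm_problem A B O) (T : comm_problem P Q Z).

Definition slice (I J : finType) (V : {set I * J}) (j : J) : {set I} :=
  [set i | (i, j) \in V].

Lemma sliceU (I J : finType) (V W : {set I * J}) j :
  slice (V :|: W) j = slice V j :|: slice W j.
Proof. by apply/setP => i; rewrite !inE. Qed.

Lemma disjoint_slice (I J : finType) (V W : {set I * J}) j :
  [disjoint V & W] -> [disjoint slice V j & slice W j].
Proof.
move=> dVW; apply/pred0P => i /=; rewrite !inE.
by apply/negP => /andP[Vi Wi]; rewrite (disjointFr dVW Vi) in Wi.
Qed.

Local Open Scope nat_scope.

(** Induction on the tree. Nonemptiness of the slices is what makes [(p, q)] belong to the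
    projection of every leaf that survives pruning. *)
Lemma protocol_projections X' Y' (pi : protocol (dsum S T) X' Y') :
  exists s : seq {set P * Q}, [/\ size s = leaves pi,
    {in s, forall W, mono_rectangle T W} &
    forall p q, slice X' p != set0 -> slice Y' q != set0 ->
    exists sg : protocol S (slice X' p) (slice Y' q),
      leaves sg <= count (fun W : {set P * Q} => (p, q) \in W) s].
Proof.
elim: pi => {X' Y'} [X' Y' [o z] mono | X' Y' X1 X2 eX dX p1 IH1 p2 IH2
                   | X' Y' Y1 Y2 eY dY p1 IH1 p2 IH2].
- have monoP a b p q : (a, p) \in X' -> (b, q) \in Y' ->
      ((a, b, o) \in valid S) && ((p, q, z) \in valid T).
    move=> Xap Ybq; have /= := forall_inP mono ((a, p), (b, q)).
    by rewrite !inE Xap Ybq => /(_ isT).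
  exists [:: setX [set p | slice X' p != set0]
                  [set q | slice Y' q != set0]].
  split=> // [W | p q Xp Yq].
    rewrite inE => /eqP->; apply/andP; split.
      by do 2![apply/existsP; eexists].
    (* Every [(p, q)] of the projection comes from some [(a, p)] and [(b, q)] in the leaf's
       rectangle, for which [(o, z)] is valid. *)
    apply/existsP; exists z; apply/forall_inP => -[p q]; rewrite !inE /=.
    case/andP=> /set0Pn[a]; rewrite inE => Xap /set0Pn[b]; rewrite inE => Ybq.
    by case/andP: (monoP a b p q Xap Ybq).
  have mono_o : mono_with S (setX (slice X' p) (slice Y' q)) o.
    apply/forall_inP => -[a b]; rewrite !inE /= => /andP[Xap Ybq].
    by case/andP: (monoP a b p q Xap Ybq).
  by exists (Leaf mono_o); rewrite /= !inE Xp Yq.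
- case: _ / eX; have [s1 [sz1 mono1 sg1P]] := IH1.
  have [s2 [sz2 mono2 sg2P]] := IH2.
  exists (s1 ++ s2); split=> [|W|p q Xp Yq]; first by rewrite size_cat sz1 sz2.
    by rewrite mem_cat => /orP[/mono1 | /mono2].
  rewrite count_cat; move: Xp; rewrite sliceU.
  (* Pruning: if one child has an empty slice, the other child's protocol replaces the whole
     node. *)
  have [-> | X1p] := eqVneq (slice X1 p) set0.
    rewrite set0U => X2p; have [sg sgP] := sg2P p q X2p Yq.
    by exists sg; apply: leq_trans sgP (leq_addl _ _).
  have [sg1 sg1_le] := sg1P p q X1p Yq.
  have [-> | X2p] := eqVneq (slice X2 p) set0.
    by rewrite setU0; exists sg1; apply: leq_trans sg1_le (leq_addr _ _).
  have [sg2 sg2_le] := sg2P p q X2p Yq.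
  exists (Alice erefl (disjoint_slice p dX) sg1 sg2).
  exact: leq_add.
- case: _ / eY; have [s1 [sz1 mono1 sg1P]] := IH1.
  have [s2 [sz2 mono2 sg2P]] := IH2.
  exists (s1 ++ s2); split=> [|W|p q Xp Yq]; first by rewrite size_cat sz1 sz2.
    by rewrite mem_cat => /orP[/mono1 | /mono2].
  rewrite count_cat; move: Yq; rewrite sliceU.
  have [-> | Y1q] := eqVneq (slice Y1 q) set0.
    rewrite set0U => Y2q; have [sg sgP] := sg2P p q Xp Y2q.
    by exists sg; apply: leq_trans sgP (leq_addl _ _).
  have [sg1 sg1_le] := sg1P p q Xp Y1q.
  have [-> | Y2q] := eqVneq (slice Y2 q) set0.
    by rewrite setU0; exists sg1; apply: leq_trans sg1_le (leq_addr _ _).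
  have [sg2 sg2_le] := sg2P p q Xp Y2q.
  exists (Bob erefl (disjoint_slice q dY) sg1 sg2).
  exact: leq_add.
Qed.

(** At the root both slices are full, so the pruned tree solves [S] and has at least [L S]
    leaves. *)
Lemma dsum_multicover :
  exists s : seq {set P * Q}, [/\ size s = L (dsum S T),
    {in s, forall W, mono_rectangle T W} &
    forall x, L S <= count (fun W : {set P * Q} => x \in W) s].
Proof.
rewrite {1}/L; case: ex_minnP => _ /asboolP[pi <-] _.
have [s [sz mono sP]] := protocol_projections pi.
exists s; split=> // -[p q].
have sliceT (I J : finType) (j : J) : slice [set: I * J] j = [set: I].
  by apply/setP => i; rewrite !inE.
have := sP p q; rewrite !sliceT -!card_gt0 !cardsT.
rewrite (inputX_gt0 S) (inputY_gt0 S).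
case=> // sg; apply: leq_trans; rewrite /L; case: ex_minnP => m _; apply.
by apply/asboolP; exists sg.
Qed.

End Slices.

(** * Positivity of [L] and [Cov], and covers given as sequences *)

Section Measures.
Variables (X Y Z : finType) (S : comm_problem X Y Z).
Local Open Scope nat_scope.

Lemma L_gt0 : 0 < L S.
Proof.
rewrite /L; case: ex_minnP => _ /asboolP[pi <-] _.
by elim: pi => //= *; apply: ltn_addr.
Qed.

Lemma Cov_le_size (c : seq {set X * Y}) :
  {in c, forall W, mono_rectangle S W} -> \bigcup_(W <- c) W = setT ->
  Cov S <= size c.
Proof.
move=> mono cT; rewrite /Cov; case: ex_minnP => m _ minm.
apply: leq_trans (minm #|[set W in c]| _) _; last first.
  by rewrite cardsE card_size.
apply/existsP; exists [set W in c]; rewrite eqxx andbT; apply/andP; split.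
  by apply/forall_inP => W; rewrite inE => /mono.
apply/eqP/setP => x; rewrite in_setT.
have : x \in \bigcup_(W <- c) W by rewrite cT inE.
rewrite bigcup_seq => /bigcupP[W cW Wx].
by apply/bigcupP; exists W; rewrite ?inE.
Qed.

Lemma Cov_gt0 : 0 < Cov S.
Proof.
rewrite /Cov; case: ex_minnP => _ /existsP[C /andP[/andP[_ /eqP cC] /eqP <-]] _.
have [x0 _] := card_gt0P (inputX_gt0 S).
have [y0 _] := card_gt0P (inputY_gt0 S).
have : (x0, y0) \in cover C by rewrite cC inE.
by case/bigcupP => W CW _; apply/card_gt0P; exists W.
Qed.

End Measures.

(** * Logarithm estimates and the number of greedy steps *)

Section Logarithm.
Variable R : realType.

Lemma ln2_gt0 : 0 < ln 2 :> R.
Proof. by rewrite ln_gt0 // ltr1n. Qed.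

Lemma log2M (x y : R) : 0 < x -> 0 < y -> log2 (x * y) = log2 x + log2 y.
Proof. by move=> x_gt0 y_gt0; rewrite /log2 lnM ?posrE // mulrDl. Qed.

Lemma log2_2 : log2 2 = 1 :> R.
Proof. by rewrite /log2 divff // gt_eqF // ln2_gt0. Qed.

Lemma ler_log2 (x y : R) : 0 < x -> x <= y -> log2 x <= log2 y.
Proof.
move=> x_gt0 le_xy; rewrite ler_wpM2r ?invr_ge0 ?(ltW ln2_gt0) //.
by rewrite ler_ln ?posrE // (lt_le_trans x_gt0).
Qed.

Lemma ln_le_log2 (x : R) : 1 <= x -> ln x <= log2 x.
Proof.
move=> x_ge1; rewrite ler_pdivlMr ?ln2_gt0 // ler_piMr ?ln_ge0 //.
(* The bound [ln (1 + x) <= x] at [x = 1] gives [ln 2 <= 1]. *)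
by have := @le_ln1Dx R 1; rewrite -natr1 addrC; apply; lra.
Qed.

(* [t] is the least integer above [(N / k) * ln n], so that
   [(1 - k / N) ^+ t <= expR (- t * k / N) < 1 / n]. *)
Lemma greedy_steps (k N n : nat) : (0 < k <= N)%N -> (1 < n)%N ->
  exists t, (n * (N - k) ^ t < N ^ t)%N /\
    k%:R * t%:R <= 2 * (N%:R * log2 n%:R) :> R.
Proof.
case/andP=> k_gt0 le_kN n_gt1.
have N_gt0 := leq_trans k_gt0 le_kN; have n_gt0 := ltnW n_gt1.
have [kR NR nR] : [/\ 0 < k%:R :> R, 0 < N%:R :> R & 0 < n%:R :> R].
  by rewrite !ltr0n.
pose x : R := N%:R * ln n%:R / k%:R.
have x_ge0 : 0 <= x by rewrite !mulr_ge0 ?invr_ge0 ?ln_ge0 ?ler1n ?ltW.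
have kxE : k%:R * x = N%:R * ln n%:R by rewrite mulrC divfK ?gt_eqF.
pose t := (Num.truncn x).+1; exists t.
have lt_xt : x < t%:R := truncnS_gt x.
have le_tx : t%:R <= x + 1.
  by rewrite -natr1 lerD2r truncn_le.
split.
  rewrite -(ltr_nat R) natrM !natrX natrB //.
  have -> : N%:R - k%:R = N%:R * (1 - k%:R / N%:R) :> R.
    by rewrite mulrBr mulr1 mulrCA divff ?mulr1 // gt_eqF.
  rewrite exprMn mulrCA -[ltRHS]mulr1 ltr_pM2l ?exprn_gt0 //.
  have le_exp : (1 - k%:R / N%:R) ^+ t <= expR (- (k%:R / N%:R) * t%:R) :> R.
    rewrite expRM_natr lerXn2r ?nnegrE ?expR_ge0 ?expR_ge1Dx //.
    by rewrite subr_ge0 ler_pdivrMr // mul1r ler_nat.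
  apply: le_lt_trans (ler_wpM2l (ltW nR) le_exp) _.
  (* With [n = expR (ln n)], the claim becomes [ln n < k * t / N], which is [x < t]. *)
  rewrite -[n%:R in ltLHS]lnK ?posrE // -expRD expR_lt1 mulNr subr_lt0.
  rewrite mulrAC ltr_pdivlMr // [ltLHS]mulrC.
  by have := lt_xt; rewrite -(ltr_pM2l kR) kxE.
have le_kt : k%:R * t%:R <= N%:R * ln n%:R + k%:R :> R.
  by have := le_tx; rewrite -(ler_pM2l kR) mulrDr kxE mulr1.
(* Rounding up costs an extra [k]; as [log2 n >= 1], it is absorbed by a second copy of
   [N * log2 n], whence the factor 2. *)
have lkN : k%:R <= N%:R * log2 n%:R :> R.
  apply: le_trans (_ : N%:R <= _); first by rewrite ler_nat.
  by rewrite ler_peMr ?(ltW NR) // -[leLHS]log2_2; apply: ler_log2;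
    rewrite ?ler_nat.
have := ler_wpM2l (ltW NR) (@ln_le_log2 n%:R _).
by rewrite ler1n => /(_ n_gt0); lra.
Qed.

End Logarithm.

(** * The two lower bounds for the direct sum *)

Section DirectSum.
Variables (R : realType) (A B O P Q Z : finType).
Variables (S : comm_problem A B O) (T : comm_problem P Q Z).

Lemma dsum_L_fooling (delta : R) (Lam : {set P * Q}) :
  Lam != set0 -> fooling_set T delta Lam ->
  (L S)%:R / delta <= (L (dsum S T))%:R.
Proof.
rewrite -card_gt0 => Lam_gt0 fool.
(* For [delta <= 0] the quotient is nonpositive, division by 0 giving 0. *)
have [delta_le0 | delta_gt0] := lerP delta 0.
  by apply: le_trans (ler0n _ _); rewrite mulr_ge0_le0 ?invr_le0.
have [s [<- mono cov]] := dsum_multicover S T.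
have := multicover_card cov Lam; rewrite -(ler_nat R) natrM natr_sum.
have LamR : 0 < #|Lam|%:R :> R by rewrite ltr0n.
(* [Lam :&: W] lies in the monochromatic rectangle [W], so it is at most a [delta] fraction of
   [Lam]. *)
have le_sum : \sum_(W <- s) #|Lam :&: W|%:R <= \sum_(W <- s) delta * #|Lam|%:R.
  rewrite big_seq [leRHS]big_seq; apply: ler_sum => W sW.
  rewrite -ler_pdivrMr // leNgt; apply/negP => /fool; apply.
    exact: subsetIl.
  by exists W; [exact: mono | exact: subsetIr].
move=> /le_trans/(_ le_sum).
rewrite big_const_seq count_predT iter_addr_0 -[leRHS]mulr_natl [leRHS]mulrA.
by rewrite ler_pM2r // ler_pdivrMr.
Qed.

Lemma dsum_L_Cov : (1 < #|P| * #|Q|)%N ->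
  (L S)%:R * (Cov T)%:R
  <= 2 * ((L (dsum S T))%:R * log2 (#|P| * #|Q|)%:R) :> R.
Proof.
rewrite -card_prod => n_gt1.
have [s [<- mono cov]] := dsum_multicover S T.
have [x _] := card_gt0P (ltnW n_gt1).
have k_gt0 := L_gt0 S; have le_ks := leq_trans (cov x) (count_size _ _).
have [|t [lt_t le_t]] := @greedy_steps R (L S) (size s) _ _ n_gt1.
  by rewrite k_gt0.
apply: le_trans le_t; rewrite ler_pM2l ?ltr0n // ler_nat.
have [c [sub_c sz_c le_c]] :=
  greedy_cover cov t (leq_trans k_gt0 le_ks) le_ks.
rewrite -sz_c; apply: Cov_le_size => [W /sub_c /mono // |].
apply/setC_inj; rewrite setCT; apply/eqP; rewrite -cards_eq0 -leqn0 leqNgt.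
(* After [t] greedy steps fewer than one pair is uncovered, hence none, and [Cov T <= t]. *)
apply/negP => unc_gt0.
have := leq_ltn_trans le_c lt_t.
by rewrite ltnNge leq_pmull.
Qed.

End DirectSum.

Theorem theorem4p3 (R : realType) (A B O P Q Z : finType)
    (S : comm_problem A B O) (T : comm_problem P Q Z) :
  (forall (delta : R) (Lam : {set P * Q}),
     Lam != set0 -> fooling_set T delta Lam ->
     (L S)%:R / delta <= (L (dsum S T))%:R)
  /\
  ((1 < #|P| * #|Q|)%N ->
     log2 (L S)%:R + log2 (Cov T)%:R - log2 (log2 (#|P| * #|Q|)%:R) - 4
     <= log2 (L (dsum S T))%:R :> R).
Proof.
split=> [delta Lam | n_gt1]; first exact: dsum_L_fooling.
have [LS_gt0 LST_gt0] : 0 < (L S)%:R :> R /\ 0 < (L (dsum S T))%:R :> R.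
  by rewrite !ltr0n !L_gt0.
have C_gt0 : 0 < (Cov T)%:R :> R by rewrite ltr0n Cov_gt0.
have log_gt0 : 0 < log2 (#|P| * #|Q|)%:R :> R.
  by rewrite divr_gt0 ?ln2_gt0 // ln_gt0 // ltr1n.
(* The factor 2 costs only [log2 2 = 1], within the allowed 4. *)
have := ler_log2 (mulr_gt0 LS_gt0 C_gt0) (dsum_L_Cov R S T n_gt1).
set l := log2 (_ * _)%:R in log_gt0 *; move: l log_gt0 => l l_gt0.
by rewrite !log2M ?mulr_gt0 // log2_2; lra.
Qed.
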